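(* For every $n\ge1$ let $\alpha_n:=|\mathcal{Y}_{2n}|$ and $\beta_n:=|\mathcal{Y}_{2n-1}|$, and set $\alpha_0:=1$. Then $\alpha_1=\beta_1=1$ and, for all $n\ge2$, $$\alpha_n=\sum_{\substack{1\le s\le n\\ s\text{ even}}}\ \sum_{\substack{r_1+\dots+r_s=n\\ r_1,\dots,r_s\ge1}}\beta_{r_1}\beta_{r_2}\cdots\beta_{r_s}+\sum_{j=1}^{n}\beta_j\beta_{n+1-j},$$ $$\beta_n=\sum_{s=1}^{n}\ \sum_{\substack{r_1+\dots+r_s=n\\ r_1,\dots,r_s\ge1}}\beta_{r_1}\beta_{r_2}\cdots\beta_{r_{s-1}}\,\alpha_{r_s-1}.$$
   Context: For $m\ge1$, $\mathcal{Y}_m$ is the set of non-crossing partitions of $[m]=\{1,\dots,m\}$ such that distinct odd elements of $[m]$ lie in distinct blocks and every block consisting only of even elements has even size. In other words, for $m=2n$ or $m=2n-1$, it is the set of non-crossing partitions of $[m]$ of the form $\sigma=\{B_1,B_3,\dots,B_{2n-1},E_1,\dots,E_r\}$ with $r\ge0$ (listed blocks pairwise distinct), $i\in B_i$ for $i=1,3,\dots,2n-1$ and $|E_j|$ even for $j\le r$. In the sums, $r_1,\dots,r_s$ are integers (ordered tuples); for $s=1$ the product $\beta_{r_1}\cdots\beta_{r_{s-1}}$ is empty and equals $1$. *)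

(* Defs.v *)
From mathcomp Require Import all_boot.

Set Implicit Arguments.
Unset Strict Implicit.
Unset Printing Implicit Defensive.

(* The ordinal i : 'I_m, with value in {0, ..., m - 1}, stands for the element
   i + 1 of [m] = {1, ..., m}. *)
Definition odd_elt m (i : 'I_m) : bool := odd i.+1.

Definition noncrossing m (P : {set {set 'I_m}}) : bool :=
  [forall A in P, forall B in P, (A != B) ==>
     ~~ [exists a in A, exists b in B, exists c in A, exists d in B,
           [&& a < b, b < c & c < d]]].

Definition Y m : {set {set {set 'I_m}}} :=
  [set P | [&& partition P [set: 'I_m], noncrossing P,
     [forall i, forall j, [&& odd_elt i, odd_elt j & i != j] ==>
        (pblock P i != pblock P j)]
   & [forall B in P, [forall i in B, ~~ odd_elt i] ==> ~~ odd #|B|]]].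

Definition alpha n : nat := if n is 0 then 1 else #|Y (2 * n)|.

(* Only meaningful for n >= 1, because of the truncated subtraction. *)
Definition beta n : nat := #|Y (2 * n - 1)|.

(* The tuples (r_1, ..., r_s) of positive integers with sum n; the entries are
   at most n, so nothing is lost by taking them in 'I_n.+1. *)
Definition compositions s n : {set s.-tuple 'I_n.+1} :=
  [set r : s.-tuple 'I_n.+1 |
     [forall i, 0 < tnth r i] && (\sum_(i < s) tnth r i == n)].

(* r_i, with i counted from 1. *)
Definition part s n (r : s.-tuple 'I_n.+1) (i : nat) : nat := nth ord0 r i.-1.

(* Main.v *)
Require Import Defs.
From mathcomp Require Import all_boot ssralg poly zify.

Set Implicit Arguments.
Unset Strict Implicit.
Unset Printing Implicit Defensive.

(** Both recurrences come from cutting a non-crossing partition at its last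
    point. Number the points from 0, let m be the last one, and let a - 1 be
    the point that precedes m in its block, with a = 0 if m is alone. No block
    joins a point below a to a point of the gap between a - 1 and m: it would
    cross the pair (a - 1, m). So the partition consists of an arbitrary
    non-crossing partition of the first a points and an arbitrary one of the
    gap, the point m being added to the block of a - 1. Counting the pairs for
    each a gives [nc_count_rec].

    The conditions defining the sets [Y m] say that a block with k odd elements
    and n elements satisfies [good_stat k n]: k = 1, or k = 0 and n is even.
    Removing m changes (k, n) in the block of a - 1 alone, and in the gap all
    blocks are unchanged. The recurrence therefore closes on the numbers
    [nc_count o Q m], where the block of the last point satisfies an arbitrary
    condition Q, all other blocks are good, and o tells which points are odd.

    Call a block pure if it has no odd element. If the last block is pure, the
    point before a gap is even, the gap has odd length and contributes some
    beta_r; removing the elements of the block one at a time yields one factor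
    beta_r for each of them. This is the sum over compositions with as many
    parts as the block has elements ([pure_count_sum]). In beta_n the last
    point is odd, the rest of its block is pure, and the last gap has even
    length: it contributes the factor alpha_(r - 1) ([betaS_sum]). In alpha_n
    the last block is either pure of even size, which gives the first sum, or
    it has exactly one odd element. Let G_n be the number of partitions of the
    second kind. The cut gives
      G_n = sum_j beta_j G_(n - j) + sum_j beta_j alpha_(n - j),
    where a gap that follows an odd point is counted by alpha after reflection
    ([nc_count_rev]). From beta_(i + 1) = alpha_i + sum_j beta_j beta_(i + 1 - j)
    ([betaS_fix]) one sees that sum_j beta_j beta_(n + 1 - j) satisfies the same
    recurrence, hence equals G_n ([mixed_count_conv]). *)

(** * Non-crossing equivalence relations *)

(** Relations on nat, constrained on the numbers below m only, are translated,
    reflected and glued by arithmetic on indices, with no casts between ordinal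
    types. *)
Record nc_equiv m (R : rel nat) : Prop := NcEquiv {
  nc_refl : forall i, i < m -> R i i;
  nc_sym : forall i j, i < m -> j < m -> R i j -> R j i;
  nc_trans : forall i j k, i < m -> j < m -> k < m -> R i j -> R j k -> R i k;
  nc_cross : forall i j k l,
    i < j -> j < k -> k < l -> l < m -> R i k -> R j l -> R i j }.

Definition nc_equivb m (R : rel nat) : bool :=
  [forall i : 'I_m, R i i && [forall j : 'I_m, (R i j ==> R j i) &&
     [forall k : 'I_m, (R i j && R j k ==> R i k) && [forall l : 'I_m,
        [&& i < j, j < k, k < l, R i k & R j l] ==> R i j]]]].

Lemma nc_equivP m R : reflect (nc_equiv m R) (nc_equivb m R).
Proof.
apply: (iffP forallP) => [ncR | [rR sR tR cR] i].
  have refl i : i < m -> R i i by move=> lim; case/andP: (ncR (Ordinal lim)).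
  have all2 i j (lim : i < m) (ljm : j < m) :=
    forallP (andP (ncR (Ordinal lim))).2 (Ordinal ljm).
  have all3 i j k (lim : i < m) (ljm : j < m) (lkm : k < m) :=
    forallP (andP (all2 i j lim ljm)).2 (Ordinal lkm).
  split=> // [i j lim ljm|i j k lim ljm lkm Rij Rjk
             |i j k l ij jk kl lm Rik Rjl].
  - by case/andP: (all2 i j lim ljm) => /implyP.
  - by case/andP: (all3 i j k lim ljm lkm) => /implyP/(_ _)->//=; rewrite Rij.
  - have lkm := ltn_trans kl lm; have ljm := ltn_trans jk lkm.
    have lim := ltn_trans ij ljm.
    case/andP: (all3 i j k lim ljm lkm) => _ /forallP/(_ (Ordinal lm))/implyP.
    by apply; rewrite /= ij jk kl Rik Rjl.
rewrite rR //=; apply/forallP=> j; apply/andP; split.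
  by apply/implyP; apply: sR.
apply/forallP=> k; apply/andP; split.
  by apply/implyP=> /andP[]; apply: tR.
by apply/forallP=> l; apply/implyP=> /and5P[ij jk kl]; apply: cR (ltn_ord l).
Qed.

(** The weight g = o counts the odd elements of the class of i, and the constant
    weight 1 all of them; one proof about gluing serves both. *)
Definition class_weight (g : nat -> nat) m (R : rel nat) i :=
  \sum_(j < m) g j * R i j.

Definition good_stat (k n : nat) := (k == 1) || (k == 0) && ~~ odd n.

Definition class_stat (o : nat -> bool) m R i (Q : nat -> nat -> bool) :=
  Q (class_weight o m R i) (class_weight (fun=> 1) m R i).

(** The class of the last point m - 1 obeys Q instead of [good_stat]. For m = 0
    there is no last point and both weights are empty sums, so that the last
    clause reads [Q 0 0]. This is the value that makes the recurrence on m hold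
    also when the last point is alone in its block. *)
Definition good_nc (o : nat -> bool) Q m R :=
  [&& nc_equivb m R,
      [forall i : 'I_m, R i m.-1 || class_stat o m R i good_stat]
    & class_stat o m R m.-1 Q].

Definition eq_upto m (R S : rel nat) :=
  forall i j, i < m -> j < m -> R i j = S i j.

Lemma eq_class_weight g m R S i : eq_upto m R S -> i < m \/ m = 0 ->
  class_weight g m R i = class_weight g m S i.
Proof.
move=> eqRS [lim|m0]; apply: eq_bigr => j _; first by rewrite eqRS.
by exfalso; case: j => j; rewrite m0.
Qed.

Lemma eq_class_stat o m R S i Q : eq_upto m R S -> i < m \/ m = 0 ->
  class_stat o m R i Q = class_stat o m S i Q.
Proof. by move=> e h; rewrite /class_stat !(eq_class_weight _ e h). Qed.

Lemma eq_nc_equiv m R S : eq_upto m R S -> nc_equiv m R -> nc_equiv m S.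
Proof.
move=> eqRS [rR sR tR cR]; split=> [i lim|i j lim ljm|i j k lim ljm lkm|].
- by rewrite -eqRS ?rR.
- by rewrite -!eqRS //; apply: sR.
- by rewrite -!eqRS //; apply: tR.
- move=> i j k l ij jk kl lm; rewrite -!eqRS; try lia; exact: cR kl lm.
Qed.

Lemma eq_upto_sym m R S : eq_upto m R S -> eq_upto m S R.
Proof. by move=> eqRS i j lim ljm; rewrite eqRS. Qed.

Lemma eq_good_nc o Q m R S : eq_upto m R S -> good_nc o Q m R = good_nc o Q m S.
Proof.
move=> eqRS; rewrite /good_nc (@eq_class_stat _ _ R S _ _ eqRS); last by lia.
congr [&& _, _ & _].
  by apply/nc_equivP/nc_equivP; apply: eq_nc_equiv => //; apply: eq_upto_sym.
apply: eq_forallb => i; have lim := ltn_ord i.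
by rewrite eqRS ?(@eq_class_stat _ _ R S _ _ eqRS); lia.
Qed.

(** * Counting non-crossing relations *)

Definition code m := {ffun 'I_m * 'I_m -> bool}.

Definition rel_of m (e : code m) : rel nat := fun i j =>
  if insub i is Some i' then if insub j is Some j' then e (i', j') else false
  else false.

Definition of_rel m (R : rel nat) : code m :=
  [ffun p : 'I_m * 'I_m => R p.1 p.2].

Lemma rel_of_ord m (e : code m) (i j : 'I_m) : rel_of e i j = e (i, j).
Proof. by rewrite /rel_of !valK. Qed.

Lemma rel_ofK m : cancel (@rel_of m) (@of_rel m).
Proof. by move=> e; apply/ffunP=> -[i j]; rewrite ffunE rel_of_ord. Qed.

Lemma of_relK m R : eq_upto m (rel_of (of_rel m R)) R.
Proof.
by move=> i j lim ljm; rewrite (rel_of_ord _ (Ordinal lim) (Ordinal ljm)) ffunE.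
Qed.

Lemma eq_of_rel m R S : eq_upto m R S -> of_rel m R = of_rel m S.
Proof. by move=> eqRS; apply/ffunP=> -[i j]; rewrite !ffunE eqRS. Qed.

Definition nc_codes o Q m := [set e : code m | good_nc o Q m (rel_of e)].
Definition nc_count o Q m := #|nc_codes o Q m|.

Lemma of_rel_nc_codes o Q m R :
  (of_rel m R \in nc_codes o Q m) = good_nc o Q m R.
Proof. by rewrite inE (eq_good_nc _ _ (@of_relK m R)). Qed.

Lemma card_inverse (T U : finType) (A : {set T}) (B : {set U}) f g :
    {in A, forall x, f x \in B} -> {in B, forall y, g y \in A} ->
    {in A, cancel f g} -> {in B, cancel g f} -> #|A| = #|B|.
Proof.
move=> fAB gBA fK gK; rewrite -(card_in_imset (can_in_inj fK)).
congr #|pred_of_set _|; apply/setP=> y; apply/imsetP/idP=> [[x Ax ->]|By].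
  exact: fAB.
by exists (g y); rewrite ?gK ?gBA.
Qed.

(** * Cutting at the last point *)

(** u lives on the first a points, v on the m - a points of the gap, and the last
    point m joins the class of a - 1 (it is alone if a = 0). *)
Definition glue a m (u v : rel nat) : rel nat := fun i j =>
  if i == m then (j == m) || (j < a) && u a.-1 j
  else if j == m then (i < a) && u i a.-1
  else if i < a then (j < a) && u i j else (a <= j) && v (i - a) (j - a).

Definition shift a (R : rel nat) : rel nat := fun i j => R (a + i) (a + j).

Variant zone a m : nat -> Prop :=
  | Low i of i < a : zone a m i
  | Mid i of i < m - a : zone a m (a + i)
  | Top : zone a m m.

Lemma zoneP a m i : a <= m -> i < m.+1 -> zone a m i.
Proof.
move=> am im; case: (ltnP i a) => [|ai]; first by constructor.
have [->|im'] := eqVneq i m; first by constructor.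
by rewrite -(subnKC ai); constructor; lia.
Qed.

Section Glue.
Variables (a m : nat) (u v : rel nat).
Hypothesis am : a <= m.
Local Notation w := (glue a m u v).

Lemma glue_ll i j : i < a -> j < a -> w i j = u i j.
Proof. by move=> ia ja; rewrite /glue !ltn_eqF ?ia ?ja //; lia. Qed.
Lemma glue_lm i : i < a -> w i m = u i a.-1.
Proof. by move=> ia; rewrite /glue (ltn_eqF (leq_trans ia am)) eqxx ia. Qed.

Lemma glue_ml i : i < a -> w m i = u a.-1 i.
Proof. by move=> ia; rewrite /glue eqxx (ltn_eqF (leq_trans ia am)) ia. Qed.

Lemma glue_lh i j : i < a -> j < m - a -> w i (a + j) = false.
Proof.
move=> ia jm; rewrite /glue !ltn_eqF ?ia ?[_ < a]ltnNge ?leq_addr //; lia.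
Qed.

Lemma glue_hl i j : i < m - a -> j < a -> w (a + i) j = false.
Proof.
move=> im ja; rewrite /glue !ltn_eqF ?[a + i < a]ltnNge ?leq_addr //=; lia.
Qed.

Lemma glue_hh i j : i < m - a -> j < m - a -> w (a + i) (a + j) = v i j.
Proof. by move=> im jm; rewrite /glue !ifF ?leq_addr ?addKn //; lia. Qed.

Lemma glue_hm i : i < m - a -> w (a + i) m = false.
Proof.
by move=> im; rewrite /glue ifF ?eqxx ?[_ < a]ltnNge ?leq_addr //; lia.
Qed.

Lemma glue_mh i : i < m - a -> w m (a + i) = false.
Proof.
move=> im; rewrite /glue eqxx [_ == m]ltn_eqF ?[_ < a]ltnNge ?leq_addr //.
by lia.
Qed.

Lemma glue_mm : w m m = true.
Proof. by rewrite /glue !eqxx. Qed.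
Definition glueE := (glue_mm, glue_hh, glue_hm, glue_mh, glue_lh, glue_hl,
  glue_lm, glue_ml, glue_ll).

Lemma nc_equiv_glue : nc_equiv m.+1 w <-> nc_equiv a u /\ nc_equiv (m - a) v.
Proof.
split=> [[r s t c]|[[ru su tu cu] [rv sv tv cv]]].
  split; split.
  - by move=> i ia; rewrite -glue_ll //; apply: r; lia.
  - by move=> i j ia ja; rewrite -!glue_ll //; apply: s; lia.
  - by move=> i j k ia ja ka; rewrite -!glue_ll //; apply: t; lia.
  - move=> i j k l ij jk kl la; rewrite -!glue_ll; try lia.
    by apply: (c) jk kl _; lia.
  - by move=> i ia; rewrite -glue_hh //; apply: r; lia.
  - by move=> i j ia ja; rewrite -!glue_hh //; apply: s; lia.
  - by move=> i j k ia ja ka; rewrite -!glue_hh //; apply: t; lia.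
  - move=> i j k l ij jk kl la; rewrite -!glue_hh; try lia.
    by apply: (c); lia.
split.
- by move=> _ /(zoneP am)[i h|i h|]; rewrite glueE; auto.
- move=> _ _ /(zoneP am)[i hi|i hi|] /(zoneP am)[j hj|j hj|];
    rewrite !glueE //; first [apply: su | apply: sv]; lia.
- move=> _ _ _ /(zoneP am)[i hi|i hi|] /(zoneP am)[j hj|j hj|]
    /(zoneP am)[k hk|k hk|]; rewrite !glueE //;
    move=> wij wjk;
    first [apply: (tu _ _ _ _ _ _ wij wjk) | apply: (tv _ _ _ _ _ _ wij wjk)];
    lia.
- move=> i j k l ij jk kl lm.
  have hi := zoneP am (ltn_trans ij (ltn_trans jk (ltn_trans kl lm))).
  have hj := zoneP am (ltn_trans jk (ltn_trans kl lm)).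
  have hk := zoneP am (ltn_trans kl lm); have hl := zoneP am lm.
  case: hi hj hk hl ij jk kl lm => [{}i hi|{}i hi|] [{}j hj|{}j hj|]
    [{}k hk|{}k hk|] [{}l hl|{}l hl|] ij jk kl lm; rewrite ?glueE //.
  all: try (exfalso; lia).
  + by move=> *; apply: (cu i j k l).
  (* l is the last point, so that j is related to a - 1 and i to k: the pairs
     cross in u unless k is a - 1 itself. *)
  + have pa : a.-1 < a by lia.
    move=> uik uja; have [ka|ka] := eqVneq k a.-1.
      apply: (tu i k j) => //.
      by apply: su => //; rewrite ka.
    by apply: (cu i j k a.-1) => //; lia.
  + by move=> *; apply: (cv i j k l) => //; lia.
Qed.

Lemma sum_split (F : nat -> nat) :
  \sum_(j < m) F j = \sum_(j < a) F j + \sum_(j < m - a) F (a + j).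
Proof.
rewrite -[in LHS](subnKC am) big_split_ord.
by congr (_ + _); apply: eq_bigr.
Qed.

Lemma class_weight_low g i : i < a ->
  class_weight g m.+1 w i = class_weight g a u i + g m * u i a.-1.
Proof.
move=> ia; rewrite /class_weight big_ord_recr /=.
rewrite (sum_split (fun j => g j * w i j)) /=.
rewrite glueE //.
rewrite [X in _ + X + _]big1 ?addn0 => [|j _]; last by rewrite glueE ?muln0.
by congr (_ + _); apply: eq_bigr => j _; rewrite glueE.
Qed.

Lemma class_weight_mid g i : i < m - a ->
  class_weight g m.+1 w (a + i) = class_weight (fun j => g (a + j)) (m - a) v i.
Proof.
move=> ia; rewrite /class_weight big_ord_recr /=.
rewrite (sum_split (fun j => g j * w (a + i) j)) /= glueE // muln0 addn0.
rewrite big1 ?add0n => [|j _]; last by rewrite glueE ?muln0.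
by apply: eq_bigr => j _; rewrite glueE.
Qed.

Lemma class_weight_top g :
  class_weight g m.+1 w m = class_weight g a u a.-1 + g m.
Proof.
rewrite /class_weight big_ord_recr /= (sum_split (fun j => g j * w m j)) /=.
rewrite glueE // muln1.
rewrite [X in _ + X + _]big1 ?addn0 => [|j _]; last by rewrite glueE ?muln0.
by congr (_ + _); apply: eq_bigr => j _; rewrite glueE.
Qed.

End Glue.

Lemma class_weight_rel m R i j g : nc_equiv m R -> i < m -> j < m -> R i j ->
  class_weight g m R i = class_weight g m R j.
Proof.
move=> [_ s t _] im jm Rij; apply: eq_bigr => k _; congr (_ * nat_of_bool _).
apply/idP/idP; last exact: t.
by apply: t => //; apply: s.
Qed.

(** With Q := [good_stat] the last class is no longer special, since the weights
    are constant on classes. *)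
Lemma good_ncP o m R :
  reflect (nc_equiv m R /\ forall i, i < m -> class_stat o m R i good_stat)
          (good_nc o good_stat m R).
Proof.
apply: (iffP and3P) => [[/nc_equivP ncR /forallP cR lR]|[ncR cR]]; split=> //.
- move=> i im; case/orP: (cR (Ordinal im)) => //= Rim.
  have m1 : m.-1 < m by lia.
  by rewrite /class_stat !(class_weight_rel _ ncR im m1 Rim).
- exact/nc_equivP.
- by apply/forallP=> i; rewrite cR ?orbT.
case: m ncR cR => [|m] _ cR; last exact: cR.
by rewrite /class_stat /class_weight !big_ord0.
Qed.

Lemma good_nc_glue o Q a m u v : a <= m ->
  good_nc o Q m.+1 (glue a m u v) =
  good_nc o (fun k n => Q (k + o m) n.+1) a u &&
  good_nc (fun i => o (a + i)) good_stat (m - a) v.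
Proof.
move=> am; apply/and3P/andP.
  case=> /nc_equivP/(nc_equiv_glue _ _ am)[ncu ncv] /forallP cw lw; split.
    apply/and3P; split; first exact/nc_equivP.
      apply/forallP=> -[i ia] /=; case uia: (u i a.-1) => //=.
      have im : i < m.+1 by lia.
      move: (cw (Ordinal im)); rewrite /class_stat /= glueE // uia.
      by rewrite !class_weight_low // uia !muln0 !addn0.
    by move: lw; rewrite /class_stat /= !class_weight_top // addn1.
  apply/good_ncP; split=> // i im.
  have im' : a + i < m.+1 by lia.
  move: (cw (Ordinal im')); rewrite /class_stat /= glueE //.
  by rewrite !class_weight_mid.
case=> /and3P[/nc_equivP ncu /forallP cu lu] /good_ncP[ncv cv].
split; first by apply/nc_equivP/nc_equiv_glue.
  apply/forallP=> -[i im] /=; case: (zoneP am im) => {im}[{}i im|{}i im|];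
    rewrite glueE //.
    move: (cu (Ordinal im)) => /=; case uia: (u _ _) => //=.
    by rewrite /class_stat !class_weight_low // uia !muln0 !addn0.
  by move: (cv _ im); rewrite /class_stat !class_weight_mid.
by move: lu; rewrite /class_stat /= !class_weight_top // addn1.
Qed.

(** One more than the predecessor of m in its class, so that 0 means that there is
    none and that the points below [pred_end m R] are exactly those of the left
    part. *)
Definition pred_end m (R : rel nat) := \max_(i < m | R i m) i.+1.

Lemma pred_end_le m R : pred_end m R <= m.
Proof. by apply/bigmax_leqP => i _. Qed.

Lemma pred_end_glue a m u v : a <= m -> nc_equiv a u ->
  pred_end m (glue a m u v) = a.
Proof.
move=> am ncu; apply/eqP; rewrite eqn_leq; apply/andP; split.
  apply/bigmax_leqP=> -[i im] /=.
  have zi := zoneP am (leqW im); case: zi im => [{}i h|{}i h|] im;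
    rewrite ?glueE //; lia.
have [->//|a0] := posnP a.
have h : a.-1 < m by lia.
rewrite -{1}(prednK a0).
apply: (@leq_bigmax_cond _ _ (fun i : 'I_m => i.+1) (Ordinal h)).
by rewrite /= glueE ?(nc_refl ncu); lia.
Qed.

(** A pair joining i below a to a + j in the gap would cross (a - 1, m), or else
    i = a - 1; in both cases a + j would belong to the class of m, although it
    lies after the predecessor of m. *)
Lemma glue_restrict m R (a := pred_end m R) : nc_equiv m.+1 R ->
  eq_upto m.+1 R (glue a m R (shift a R)).
Proof.
move=> [r s t c]; have am : a <= m := pred_end_le m R.
have aP : 0 < a -> R a.-1 m.
  rewrite /a /pred_end => a0.
  have [|i Rim] := eq_bigmax_cond (fun i : 'I_m => i.+1)
    (A := fun i : 'I_m => R i m).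
    rewrite lt0n; apply: contraTneq a0 => /card0_eq R0.
    by rewrite big_pred0.
  by rewrite unfold_in in Rim; move=> ->.
have aN i : i < m - a -> ~~ R (a + i) m.
  move=> im; apply/negP=> Ram.
  have h : a + i < m by lia.
  have := @leq_bigmax_cond _ (fun j : 'I_m => R j m) (fun j : 'I_m => j.+1)
    (Ordinal h) Ram.
  by rewrite -/(pred_end m R) -/a /=; lia.
have cut i j : i < a -> j < m - a -> R i (a + j) = false.
  move=> ia jm; apply/negP=> Rij; case/negP: (aN j jm).
  have Ram : R a.-1 m by apply: aP; lia.
  apply: (t _ i); try lia; first by apply: s => //; lia.
  have [->//|ia'] := eqVneq i a.-1.
  apply: (t _ a.-1) => //; try lia.
  apply: (c _ a.-1 (a + j) m) => //; lia.
have cut' i j : i < m - a -> j < a -> R (a + i) j = false.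
  move=> im ja; apply/negP=> /s Rij.
  by have := cut j i ja im; rewrite Rij //; lia.
have top i : i < a -> R i m = R i a.-1.
  move=> ia; have Ram : R a.-1 m by apply: aP; lia.
  by apply/idP/idP=> h; [apply: (t _ m)|apply: (t _ a.-1)] => //; try lia;
    apply: s => //; lia.
have top' i : i < a -> R m i = R a.-1 i.
  move=> ia; have Ram : R a.-1 m by apply: aP; lia.
  by apply/idP/idP=> h; [apply: (t _ m)|apply: (t _ a.-1)] => //; try lia;
    apply: s => //; lia.
move=> _ _ /(zoneP am)[i hi|i hi|] /(zoneP am)[j hj|j hj|]; rewrite glueE //.
- exact: cut.
- exact: top.
- exact: cut'.
- exact/negbTE/aN.
- exact: top'.
- apply/negP=> /s h; case/negP: (aN j hj); apply: h => //; lia.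
- exact: r.
Qed.

Lemma rel_of_glueK a m R S : a <= m ->
  let w := rel_of (of_rel m.+1 (glue a m R S)) in
  eq_upto a w R /\ eq_upto (m - a) (shift a w) S.
Proof.
move=> am /=; split=> i j hi hj; rewrite /shift of_relK ?glueE //; lia.
Qed.

Lemma eq_pred_end m R S : eq_upto m.+1 R S -> pred_end m R = pred_end m S.
Proof.
move=> eqRS; apply: eq_bigl => i.
by rewrite eqRS ?ltnS ?(ltnW (ltn_ord i)).
Qed.

Lemma eq_glue a m R R' S S' :
  a <= m -> eq_upto a R R' -> eq_upto (m - a) S S' ->
  eq_upto m.+1 (glue a m R S) (glue a m R' S').
Proof.
move=> am eR eS _ _ /(zoneP am)[i hi|i hi|] /(zoneP am)[j hj|j hj|];
  rewrite !glueE //; try (by apply: eS); apply: eR => //; lia.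
Qed.

(** Once the position of the predecessor is fixed, restriction to the left part and
    to the gap is inverse to gluing, and the two parts can be chosen
    independently. *)
Lemma card_glue o Q a m : a <= m ->
  #|[set e in nc_codes o Q m.+1 | pred_end m (rel_of e) == a]| =
  nc_count o (fun k n => Q (k + o m) n.+1) a *
  nc_count (fun i => o (a + i)) good_stat (m - a).
Proof.
move=> am; rewrite -cardsX.
pose f (e : code m.+1) :=
  (of_rel a (rel_of e), of_rel (m - a) (shift a (rel_of e))).
pose g (p : code a * code (m - a)) :=
  of_rel m.+1 (glue a m (rel_of p.1) (rel_of p.2)).
have glueP e :
    e \in [set e in nc_codes o Q m.+1 | pred_end m (rel_of e) == a] ->
    eq_upto m.+1 (rel_of e) (glue a m (rel_of e) (shift a (rel_of e))).
  rewrite !inE => /andP[/and3P[/nc_equivP nce _ _] /eqP <-].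
  exact: glue_restrict.
apply: (@card_inverse _ _ _ _ f g).
- move=> e he; rewrite in_setX !of_rel_nc_codes -good_nc_glue //.
  rewrite -(eq_good_nc _ _ (glueP e he)).
  by move: he; rewrite !inE => /andP[].
- move=> [u v]; rewrite !inE /= => uv.
  rewrite (eq_good_nc _ _ (@of_relK _ _)) good_nc_glue // uv /=.
  rewrite (eq_pred_end (@of_relK _ _)) pred_end_glue //.
  by case/andP: uv => /and3P[/nc_equivP].
- move=> e /glueP eqe; rewrite -[RHS]rel_ofK; apply: eq_of_rel => i j im jm.
  rewrite eqe //; apply: eq_glue => //; exact: of_relK.
- move=> [u v] _; rewrite /f /g /=.
  have [eu ev] := rel_of_glueK (rel_of u) (rel_of v) am.
  by rewrite (eq_of_rel eu) (eq_of_rel ev) !rel_ofK.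
Qed.

Lemma nc_count_rec o Q m : nc_count o Q m.+1 =
  \sum_(a < m.+1)
    nc_count o (fun k n => Q (k + o m) n.+1) a *
    nc_count (fun i => o (a + i)) good_stat (m - a).
Proof.
rewrite /nc_count -sum1_card.
rewrite (partition_big
  (fun e => inord (pred_end m (rel_of e)) : 'I_m.+1) predT) //=.
apply: eq_bigr => a _; have am : a <= m by rewrite -ltnS.
rewrite -(card_glue o Q am) -sum1_card.
apply: eq_bigl => e; rewrite inE; congr (_ && _).
by rewrite -val_eqE /= inordK // ltnS pred_end_le.
Qed.

(** * Partitions as relations *)

(** Point i stands for the element i + 1 of [m]. *)
Definition odd_point (i : nat) := ~~ odd i.

Definition code_of m (P : {set {set 'I_m}}) : code m :=
  [ffun p : 'I_m * 'I_m => p.2 \in pblock P p.1].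

Section YPart.
Variables (m : nat) (P : {set {set 'I_m}}).
Hypothesis partP : partition P [set: 'I_m].
Local Notation R := (rel_of (code_of P)).

Lemma code_ofE (i j : 'I_m) : R i j = (pblock P i == pblock P j).
Proof.
case/and3P: partP => /eqP cP tP _.
by rewrite rel_of_ord ffunE eq_pblock ?cP.
Qed.

Lemma pblockP (i : 'I_m) : pblock P i \in P.
Proof. by case/and3P: partP => /eqP cP _ _; rewrite pblock_mem ?cP. Qed.

Lemma mem_blockE B (i : 'I_m) : B \in P -> (i \in B) = (pblock P i == B).
Proof.
case/and3P: partP => /eqP cP tP _ PB; apply/idP/eqP => [iB|<-].
  exact: def_pblock.
by rewrite mem_pblock cP.
Qed.

Lemma noncrossing_code_of : noncrossing P = nc_equivb m R.
Proof.
apply/idP/nc_equivP => [ncP|[_ _ _ c]].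
  split=> [i im|i j im jm|i j k im jm km|].
  - by rewrite (code_ofE (Ordinal im) (Ordinal im)).
  - by rewrite (code_ofE (Ordinal im) (Ordinal jm))
               (code_ofE (Ordinal jm) (Ordinal im)) eq_sym.
  - by rewrite (code_ofE (Ordinal im) (Ordinal jm))
       (code_ofE (Ordinal jm) (Ordinal km)) (code_ofE (Ordinal im) (Ordinal km))
       => /eqP->.
  move=> i j k l ij jk kl lm.
  have km := ltn_trans kl lm; have jm := ltn_trans jk km.
  have im := ltn_trans ij jm.
  rewrite (code_ofE (Ordinal im) (Ordinal km))
    (code_ofE (Ordinal jm) (Ordinal lm)) (code_ofE (Ordinal im) (Ordinal jm))
    => ik jl.
  apply: contraT => nij.
  have := forall_inP (forall_inP ncP _ (pblockP (Ordinal im))) _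
    (pblockP (Ordinal jm)).
  rewrite nij /= => /negP[].
  apply/exists_inP; exists (Ordinal im); first by rewrite mem_blockE ?pblockP.
  apply/exists_inP; exists (Ordinal jm); first by rewrite mem_blockE ?pblockP.
  apply/exists_inP; exists (Ordinal km).
    by rewrite mem_blockE ?pblockP // eq_sym.
  apply/exists_inP; exists (Ordinal lm).
    by rewrite mem_blockE ?pblockP // eq_sym.
  by rewrite /= ij jk kl.
apply/forall_inP=> A PA; apply/forall_inP=> B PB; apply/implyP; apply: contra.
move=> /exists_inP[i iA /exists_inP[j jB /exists_inP[k kA /exists_inP[l lB]]]].
move=> /and3P[ij jk kl]; move: iA jB kA lB; rewrite !mem_blockE //.
move=> /eqP iA /eqP jB /eqP kA /eqP lB.
have := c i j k l ij jk kl (ltn_ord l).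
by rewrite !code_ofE iA jB kA lB; apply.
Qed.

Lemma code_of_weight g (i : 'I_m) :
  class_weight g m R i = \sum_(j in pblock P i) g j.
Proof.
rewrite /class_weight [RHS]big_mkcond; apply: eq_bigr => j _.
rewrite code_ofE mem_blockE ?pblockP // eq_sym.
by case: eqP; rewrite ?muln1 ?muln0.
Qed.

(** A block has at most one odd element and, if it has none, an even number of
    elements: these two requirements together are [good_stat]. *)
Lemma mem_Y_code_of : (P \in Y m) = good_nc odd_point good_stat m R.
Proof.
rewrite inE partP noncrossing_code_of /=.
pose k (B : {set 'I_m}) := #|[set j in B | odd_elt j]|.
have stat (i : 'I_m) : class_stat odd_point m R i good_stat =
    good_stat (k (pblock P i)) #|pblock P i|.
  rewrite /class_stat !code_of_weight sum1_card; congr (good_stat _ _).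
  rewrite /k -sum1dep_card big_mkcondr; apply: eq_bigr => j _.
  by rewrite /odd_elt /odd_point /=; case: odd.
apply/and3P/good_ncP => [[/nc_equivP ncR sep even]|[ncR st]].
  split=> // i im; rewrite (stat (Ordinal im)).
  set B := pblock P _; have PB : B \in P by apply: pblockP.
  rewrite /good_stat; case: (ltngtP (k B) 1) => [k1|k1|] //.
    have k0 : k B == 0 by lia.
    rewrite k0; apply: (implyP (forall_inP even B PB)).
    apply/forall_inP=> j jB; apply/negP=> oj.
    move: k0; rewrite /k cards_eq0 => /eqP/setP/(_ j).
    by rewrite !inE jB oj.
  case/card_gt1P: k1 => a [b []]; rewrite !inE !mem_blockE //.
  move=> /andP[/eqP aB oa] /andP[/eqP bB ob] ab.
  have := implyP (forallP (forallP sep a) b).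
  by rewrite oa ob ab aB bB eqxx => /(_ isT).
have {}st i : good_stat (k (pblock P i)) #|pblock P i| by rewrite -stat st.
split; first exact/nc_equivP.
  apply/forallP=> a; apply/forallP=> b; apply/implyP=> /and3P[oa ob ab].
  apply/negP=> /eqP eab; move: (st a); rewrite /good_stat.
  suff : 1 < k (pblock P a) by lia.
  apply/card_gt1P; exists a, b; rewrite !inE oa ob ab; split=> //.
    by rewrite mem_blockE ?pblockP ?eqxx.
  by rewrite mem_blockE ?pblockP // eab eqxx.
apply/forall_inP=> B PB; apply/implyP=> evB.
have [B0|[i iB]] := set_0Vmem B.
  by case/and3P: partP => _ _; rewrite -B0 PB.
have := st i; move: iB; rewrite mem_blockE // => /eqP->.
suff -> : k B = 0 by [].
apply/eqP; rewrite cards_eq0; apply/eqP/setP=> j; rewrite !inE.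
by apply/negP=> /andP[jB]; apply/negP/(forall_inP evB).
Qed.

End YPart.

Lemma card_Y m : #|Y m| = nc_count odd_point good_stat m.
Proof.
pose g (e : code m) :=
  equivalence_partition (fun i j : 'I_m => e (i, j)) [set: 'I_m].
have gP e : e \in nc_codes odd_point good_stat m ->
    partition (g e) [set: 'I_m] /\ code_of (g e) = e.
  rewrite inE => /and3P[/nc_equivP[r s t _] _ _].
  have er : {in [set: 'I_m] & &, equivalence_rel (fun i j => e (i, j))}.
    move=> i j k _ _ _; split=> [|eij]; first by rewrite -rel_of_ord r.
    move: eij; rewrite -!rel_of_ord => eij; apply/idP/idP; last exact: t.
    by apply: t => //; apply: s.
  split; first exact: equivalence_partitionP.
  by apply/ffunP=> -[i j]; rewrite ffunE pblock_equivalence_partition ?inE.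
have YP P : P \in Y m -> partition P [set: 'I_m] by rewrite inE => /and4P[].
apply: (@card_inverse _ _ _ _ (@code_of m) g) => [P PY|e he|P /YP pP|e /gP[]//].
- by rewrite inE -mem_Y_code_of // YP.
- have [pe ce] := gP e he; rewrite mem_Y_code_of // ce.
  by move: he; rewrite inE.
rewrite -[RHS](equivalence_partition_pblock pP) /g.
apply: eq_imset => i; apply/setP=> j; rewrite !inE.
by rewrite ffunE.
Qed.

(** * Variation of the parameters, and reflection *)

Lemma eq_nc_count o o' Q Q' m : (forall i, i < m -> o i = o' i) ->
  (forall k n, Q k n = Q' k n) -> nc_count o Q m = nc_count o' Q' m.
Proof.
move=> eo eQ; apply: eq_card => e; rewrite !inE.
have eS i Q1 Q2 : (forall k n, Q1 k n = Q2 k n) ->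
    class_stat o m (rel_of e) i Q1 = class_stat o' m (rel_of e) i Q2.
  move=> eQ12; rewrite /class_stat eQ12; congr (Q2 _ _).
  by apply: eq_bigr => j _; rewrite eo.
congr [&& _, _ & _]; last exact: eS.
by apply: eq_forallb => i; congr (_ || _); apply: eS.
Qed.

Lemma nc_count_split o Q Q1 Q2 m : (forall k n, Q k n = Q1 k n || Q2 k n) ->
  (forall k n, ~~ (Q1 k n && Q2 k n)) ->
  nc_count o Q m = nc_count o Q1 m + nc_count o Q2 m.
Proof.
move=> QU QI; rewrite /nc_count -cardsUI [X in _ + X](_ : _ = 0) ?addn0.
  apply: eq_card => e; rewrite !inE /good_nc [class_stat _ _ _ _ Q]QU.
  by rewrite -!andb_orr.
apply/eqP; rewrite cards_eq0; apply/eqP/setP=> e; rewrite !inE.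
apply/negP=> /andP[/and3P[_ _ q1] /and3P[_ _ q2]].
by have := QI (class_weight o m (rel_of e) m.-1)
  (class_weight (fun=> 1) m (rel_of e) m.-1); rewrite [Q1 _ _]q1 [Q2 _ _]q2.
Qed.

Lemma nc_count0 o Q : nc_count o Q 0 = Q 0 0.
Proof.
have E e : (e \in nc_codes o Q 0) = Q 0 0.
  rewrite inE /good_nc /class_stat /class_weight !big_ord0.
  by rewrite (_ : nc_equivb _ _) 1?(_ : [forall i, _]) //; apply/forallP=> -[].
case q : (Q 0 0).
  transitivity #|[set: code 0]|.
    by apply: eq_card => e; rewrite E q inE.
  by rewrite cardsT card_ffun card_prod card_ord expn0.
by apply/eqP; rewrite cards_eq0; apply/eqP/setP=> e; rewrite E q inE.
Qed.

Definition rev_rel m (R : rel nat) : rel nat :=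
  fun i j => R (m.-1 - i) (m.-1 - j).

Lemma class_weight_rev g g' m R i : (forall j, j < m -> g j = g' (m.-1 - j)) ->
  class_weight g m (rev_rel m R) i = class_weight g' m R (m.-1 - i).
Proof.
move=> gg'; rewrite /class_weight [RHS](reindex_inj rev_ord_inj) /=.
apply: eq_bigr => j _; have jm := ltn_ord j.
by rewrite /rev_rel gg' //; congr (g' _ * R _ _); lia.
Qed.

Lemma good_nc_rev o o' m R : (forall i, i < m -> o i = o' (m.-1 - i)) ->
  good_nc o' good_stat m R -> good_nc o good_stat m (rev_rel m R).
Proof.
move=> oo' /good_ncP[[r s t c] st]; apply/good_ncP; split; first split.
- by move=> i im; apply: r; lia.
- by move=> i j im jm; apply: s; lia.
- by move=> i j k im jm km; apply: t; lia.
- move=> i j k l ij jk kl lm ik jl.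
  have lj : R (m.-1 - l) (m.-1 - j) by apply: s => //; lia.
  have ki : R (m.-1 - k) (m.-1 - i) by apply: s => //; lia.
  have lk : R (m.-1 - l) (m.-1 - k) by apply: (c) lj ki; lia.
  have kl' : R (m.-1 - k) (m.-1 - l) by apply: s => //; lia.
  have kj : R (m.-1 - k) (m.-1 - j) by apply: (t _ (m.-1 - l)) => //; lia.
  by apply: (t _ (m.-1 - k)) => //; lia.
- move=> i im; rewrite /class_stat (class_weight_rev _ _ (g' := o')); last first.
    by move=> j jm; rewrite oo'.
  by rewrite (class_weight_rev _ _ (g' := fun=> 1)) //; apply: st; lia.
Qed.

Lemma rev_relK m R : eq_upto m (rev_rel m (rev_rel m R)) R.
Proof. by move=> i j im jm; rewrite /rev_rel; congr (R _ _); lia. Qed.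

Lemma eq_rev_rel m R S : eq_upto m R S -> eq_upto m (rev_rel m R) (rev_rel m S).
Proof. by move=> eRS i j im jm; apply: eRS; lia. Qed.

(** Used for the gaps of even length that start at an even element: they are the
    mirror images of those that start at an odd element. The condition on the
    last class has to be [good_stat], because reflection moves the last point. *)
Lemma nc_count_rev o o' m : (forall i, i < m -> o i = o' (m.-1 - i)) ->
  nc_count o good_stat m = nc_count o' good_stat m.
Proof.
move=> oo'; pose f e := of_rel m (rev_rel m (@rel_of m e)).
have fK : cancel f f.
  move=> e; rewrite -[RHS]rel_ofK; apply: eq_of_rel => i j im jm.
  by rewrite (eq_rev_rel (@of_relK _ _)) // rev_relK.
apply: (@card_inverse _ _ _ _ f f) => [e|e|e _|e _] //.
  rewrite of_rel_nc_codes inE; apply: good_nc_rev => i im.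
  by rewrite oo'; [congr o' | ]; lia.
by rewrite of_rel_nc_codes inE; apply: good_nc_rev.
Qed.

(** * Convolution of sequences *)

Definition conv (f g : nat -> nat) n := \sum_(i < n.+1) f i * g (n - i).

Lemma eq_conv f f' g g' n : (forall i, i <= n -> f i = f' i) ->
  (forall i, i <= n -> g i = g' i) -> conv f g n = conv f' g' n.
Proof.
move=> ef eg; apply: eq_bigr => i _.
by rewrite ef ?eg ?leq_subr // -ltnS.
Qed.

Lemma convDl f g h n : conv (fun i => f i + g i) h n = conv f h n + conv g h n.
Proof. by rewrite -big_split; apply: eq_bigr => i _; rewrite mulnDl. Qed.

Lemma convDr f g h n : conv f (fun i => g i + h i) n = conv f g n + conv f h n.
Proof. by rewrite -big_split; apply: eq_bigr => i _; rewrite mulnDr. Qed.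

Lemma conv_suml (I : Type) (r : seq I) (P : pred I) (F : I -> nat -> nat) g n :
  conv (fun i => \sum_(s <- r | P s) F s i) g n =
  \sum_(s <- r | P s) conv (F s) g n.
Proof. by rewrite exchange_big; apply: eq_bigr => i _; rewrite big_distrl. Qed.

Lemma conv_sumr (I : Type) (r : seq I) (P : pred I) (F : I -> nat -> nat) g n :
  conv g (fun i => \sum_(s <- r | P s) F s i) n =
  \sum_(s <- r | P s) conv g (F s) n.
Proof. by rewrite exchange_big; apply: eq_bigr => i _; rewrite big_distrr. Qed.

(** Commutativity and associativity are inherited from the product of
    polynomials with natural coefficients. *)
Lemma conv_coef f g M n : n < M ->
  conv f g n = ((\poly_(i < M) f i * \poly_(i < M) g i)`_n)%R.
Proof.
move=> nM; rewrite coefM; apply: eq_bigr => i _; rewrite !coef_poly.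
by rewrite !ifT //; have := ltn_ord i; lia.
Qed.

Lemma convC f g n : conv f g n = conv g f n.
Proof. by rewrite !(conv_coef _ _ (ltnSn n)) GRing.mulrC. Qed.

Lemma convA f g h n : conv f (conv g h) n = conv (conv f g) h n.
Proof.
pose p f : {poly nat} := (\poly_(i < n.+1) f i)%R.
transitivity ((p f * p g * p h)`_n)%R.
  rewrite -GRing.mulrA coefM; apply: eq_bigr => i _.
  rewrite coef_poly ltn_ord (@conv_coef _ _ n.+1) //; lia.
rewrite coefM; apply: eq_bigr => i _; rewrite (@conv_coef _ _ n.+1) //.
by rewrite [((p h)`_ _)%R]coef_poly ifT //; lia.
Qed.

Definition delta n : nat := n == 0.

Lemma conv_delta f n : conv delta f n = f n.
Proof. by rewrite /conv big_ord_recl mul1n subn0 big1 ?addn0. Qed.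

(** Multiplication of the generating function by the variable. *)
Definition delay (f : nat -> nat) n := if n is k.+1 then f k else 0.

Lemma conv_delayS f g n : conv (delay f) g n.+1 = conv f g n.
Proof. by rewrite /conv big_ord_recl add0n; apply: eq_bigr. Qed.

Lemma conv_delay0 f g : conv (delay f) g 0 = 0.
Proof. by rewrite /conv big_ord1. Qed.

Lemma eq_conv_delay f g g' n : (forall i, i < n -> g i = g' i) ->
  conv (delay f) g n = conv (delay f) g' n.
Proof.
case: n => [|n] eg; rewrite ?conv_delay0 // !conv_delayS.
by apply: eq_conv => // i; apply: eg.
Qed.

(** The delay makes the right-hand side depend on earlier values only. *)
Lemma conv_delay_fix f h g g' :
  (forall n, g n = h n + conv (delay f) g n) ->
  (forall n, g' n = h n + conv (delay f) g' n) -> g =1 g'.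
Proof.
move=> eg eg' n; elim/ltn_ind: n => n IHn.
by rewrite eg eg'; congr (_ + _); apply: eq_conv_delay.
Qed.

Lemma iter_conv0 f g s n : n < s -> iter s (conv (delay f)) g n = 0.
Proof.
elim: s n => // s IHs [|n] ns; rewrite iterS ?conv_delay0 // conv_delayS.
by rewrite /conv big1 // => i _; rewrite IHs ?muln0 //; lia.
Qed.

Lemma conv_iter f g s n :
  conv (iter s (conv f) delta) g n = iter s (conv f) g n.
Proof.
elim: s n => [|s IHs] n; first exact: conv_delta.
by rewrite !iterS -convA; apply: eq_conv => i.
Qed.

Lemma iter_conv_delta f s n :
  iter s.+1 (conv f) delta n = iter s (conv f) f n.
Proof.
elim: s n => [|s IHs] n; first by rewrite /= convC conv_delta.
by rewrite /=; apply: eq_conv => i // _; apply: IHs.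
Qed.

(** * Sums over compositions *)

Lemma sum_tupleS (T : finType) s
    (P : pred (s.+1.-tuple T)) (F : s.+1.-tuple T -> nat) :
  \sum_(t | P t) F t =
  \sum_(x : T) \sum_(t : s.-tuple T | P [tuple of x :: t]) F [tuple of x :: t].
Proof.
rewrite pair_big_dep /=.
rewrite (reindex (fun p : T * s.-tuple T => [tuple of p.1 :: p.2])) /=.
  by apply: eq_bigl => -[x t].
exists (fun t => (thead t, [tuple of behead t])) => [[x t] _|t _] /=.
  by congr (_, _); apply: val_inj.
by rewrite -tuple_eta.
Qed.

(** The bound M on the entries is kept apart from the sum n, so that the induction
    on the number of parts, which lowers n, stays within one type of entries. *)
Lemma sum_tuple_conv M (f g : nat -> nat) s n : n <= M ->
  \sum_(t : s.+1.-tuple 'I_M.+1 | \sum_(x <- t) (x : nat) == n)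
     (\prod_(i < s) f (nth ord0 t i)) * g (nth ord0 t s) =
  iter s (conv f) g n.
Proof.
elim: s n => [|s IHs] n nM; rewrite sum_tupleS.
  rewrite (bigD1 (inord n)) //= [X in _ + X]big1 ?addn0.
    rewrite (big_pred1 [tuple]) => [|t]; last first.
      by rewrite tuple0 /= big_seq1 inordK ?eqxx.
    by rewrite big_ord0 mul1n inordK.
  move=> i ni; rewrite big_pred0 // => t; rewrite tuple0 big_seq1.
  by apply: contra_neqF ni => /eqP <-; rewrite inord_val.
rewrite iterS /conv.
pose G i := f i * iter s (conv f) g (n - i).
transitivity (\sum_(i < M.+1) if i < n.+1 then G i else 0).
  apply: eq_bigr => x _; case: ifP => xn; last first.
    by rewrite big_pred0 // => t; rewrite /= big_cons; lia.
  rewrite /G -IHs ?big_distrr; last by lia.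
  apply: eq_big => [t|t _] /=; first by rewrite big_cons; lia.
  by rewrite big_ord_recl mulnA.
by rewrite -big_mkcond -(big_ord_widen _ G).
Qed.

(** Since f and g vanish at 0, tuples with a zero entry may be included. *)
Lemma sum_compositions (f g : nat -> nat) s n : f 0 = 0 -> g 0 = 0 ->
  \sum_(r in compositions s.+1 n)
    (\prod_(i < s) f (nth ord0 r i)) * g (nth ord0 r s) = iter s (conv f) g n.
Proof.
move=> f0 g0; rewrite -(sum_tuple_conv _ _ _ (leqnn n)).
rewrite [RHS]big_mkcond [LHS]big_mkcond; apply: eq_bigr => t _.
rewrite inE big_tuple; case: eqP => _; last by rewrite andbF.
rewrite andbT; case: ifP => // /negbT/forallPn[i].
rewrite -eqn0Ngt (tnth_nth ord0).
have [->|ni] := eqVneq (i : nat) s; first by move/eqP=> ->; rewrite g0 muln0.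
have im : i < s by have := ltn_ord i; lia.
by move=> /eqP ti; rewrite (bigD1 (Ordinal im)) //= ti f0.
Qed.

Lemma compositions_gt0 s n (r : s.-tuple 'I_n.+1) i : r \in compositions s n ->
  i < s -> 0 < nth ord0 r i.
Proof.
rewrite inE => /andP[/forallP r0 _] im.
by have := r0 (Ordinal im); rewrite (tnth_nth ord0).
Qed.

(** * The counting sequences *)

Definition pure_stat p (k n : nat) := (k == 0) && (odd n == p).
Definition mixed_stat (k n : nat) := k == 1.

(** Shifted so that the meaningless value [beta 0] never occurs. *)
Definition betaS n := beta n.+1.
Definition pure_count p n := nc_count odd_point (pure_stat p) (2 * n).
Definition mixed_count n := nc_count odd_point mixed_stat (2 * n).

Lemma betaE n : beta n.+1 = nc_count odd_point good_stat (2 * n).+1.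
Proof. by rewrite /beta card_Y; congr (nc_count _ _ _); lia. Qed.

Lemma alphaE n : alpha n = nc_count odd_point good_stat (2 * n).
Proof. by case: n => [|n]; [rewrite nc_count0|rewrite /alpha card_Y]. Qed.

Lemma nc_count_pure0 (o : nat -> bool) (Q : nat -> nat -> bool) m :
  (forall k n, Q k n -> k = 0) -> o m -> nc_count o Q m.+1 = 0.
Proof.
move=> Q0 om; apply/eqP; rewrite cards_eq0; apply/eqP/setP=> e; rewrite !inE.
apply/negP=> /and3P[/nc_equivP[r _ _ _] _ /Q0].
rewrite /class_weight big_ord_recr /= om r //; lia.
Qed.

Lemma sum_parity (F : nat -> nat) n :
  \sum_(a < 2 * n) F a = \sum_(j < n) F (2 * j) + \sum_(j < n) F (2 * j).+1.
Proof.
elim: n => [|n IHn]; first by rewrite !big_ord0.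
rewrite (_ : 2 * n.+1 = (2 * n).+2); last by lia.
by rewrite !big_ord_recr /= IHn -!addnA; congr (_ + _); rewrite addnCA.
Qed.

Lemma pure_count0 p : pure_count p 0 = ~~ p.
Proof. by rewrite /pure_count muln0 nc_count0; case: p. Qed.

(** The last point is even. If its predecessor is even, or absent, the gap starts
    at an odd element and has odd length; if its predecessor is odd, the gap
    starts at an even element and has even length, and is counted by alpha after
    reflection. *)
Lemma nc_count_even Q n : nc_count odd_point Q (2 * n.+1) =
  \sum_(j < n.+1)
     nc_count odd_point (fun k l => Q k l.+1) (2 * j) * betaS (n - j)
  + \sum_(j < n.+1)
     nc_count odd_point (fun k l => Q k l.+1) (2 * j).+1 * alpha (n - j).
Proof.
have em : odd_point (2 * n).+1 = 0 :> nat.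
  by rewrite /odd_point /= mul2n odd_double.
have e2 : 2 * n.+1 = (2 * n).+2 by lia.
pose F a :=
  nc_count odd_point (fun k l => Q (k + odd_point (2 * n).+1) l.+1) a *
  nc_count (fun i => odd_point (a + i)) good_stat ((2 * n).+1 - a).
have := sum_parity F n.+1; rewrite e2 nc_count_rec => ->.
congr (_ + _); apply: eq_bigr => j _; rewrite /F.
  congr (_ * _); first by apply: eq_nc_count => // k l; rewrite em addn0.
  rewrite /betaS betaE (_ : (2 * n).+1 - 2 * j = (2 * (n - j)).+1); last first.
    by have := ltn_ord j; lia.
  by apply: eq_nc_count => // i _; rewrite /odd_point mul2n oddD odd_double.
congr (_ * _); first by apply: eq_nc_count => // k l; rewrite em addn0.
rewrite alphaE (_ : (2 * n).+1 - (2 * j).+1 = 2 * (n - j)); last by lia.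
by apply: nc_count_rev => i im; rewrite /odd_point; lia.
Qed.

(** The last point is odd, hence the unique odd element of its block, and the gap
    before it starts at an odd element. *)
Lemma nc_count_odd (Q : nat -> nat -> bool) n : (forall k l, Q k l -> k <= 1) ->
  nc_count odd_point Q (2 * n).+1 =
  \sum_(j < n.+1)
     nc_count odd_point (fun k l => Q k.+1 l.+1) (2 * j) * alpha (n - j).
Proof.
move=> Q1; have em : odd_point (2 * n) = 1 :> nat.
  by rewrite /odd_point mul2n odd_double.
pose F a := nc_count odd_point (fun k l => Q (k + odd_point (2 * n)) l.+1) a *
  nc_count (fun i => odd_point (a + i)) good_stat (2 * n - a).
rewrite nc_count_rec big_ord_recr /= (sum_parity F).
(* An odd predecessor would give the block of the last point two odd elements. *)
rewrite [X in _ + X + _]big1 => [|j _]; last first.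
  rewrite /F nc_count_pure0 //; first by move=> k l /Q1; rewrite em; lia.
  by rewrite /odd_point mul2n odd_double.
rewrite addn0 [RHS]big_ord_recr /= /F.
have step j : j <= n ->
    nc_count odd_point (fun k l => Q (k + odd_point (2 * n)) l.+1) (2 * j) *
    nc_count (fun i => odd_point (2 * j + i)) good_stat (2 * n - 2 * j) =
    nc_count odd_point (fun k l => Q k.+1 l.+1) (2 * j) * alpha (n - j).
  move=> jn; congr (_ * _).
    by apply: eq_nc_count => // k l; rewrite em addn1.
  rewrite alphaE -mulnBr; apply: eq_nc_count => // i _.
  by rewrite /odd_point mul2n oddD odd_double.
congr (_ + _); last exact: step.
by apply: eq_bigr => j _; apply: step; apply: ltnW.
Qed.

Lemma pure_countS p n : pure_count p n.+1 = conv (pure_count (~~ p)) betaS n.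
Proof.
rewrite /pure_count nc_count_even [X in _ + X]big1 ?addn0 => [|j _]; last first.
  rewrite nc_count_pure0 // => [k l /andP[/eqP]//|].
  by rewrite /odd_point mul2n odd_double.
apply: eq_bigr => j _; congr (_ * _).
by apply: eq_nc_count => // k l; rewrite /pure_stat /= eqb_negLR.
Qed.

Lemma betaS_conv n :
  betaS n = conv (fun i => pure_count false i + pure_count true i) alpha n.
Proof.
rewrite /betaS betaE nc_count_odd; last by move=> k l; rewrite /good_stat; lia.
apply: eq_bigr => j _; congr (_ * _).
by apply: nc_count_split => k l; rewrite /good_stat /pure_stat; lia.
Qed.

Lemma alpha_split n : alpha n = pure_count false n + mixed_count n.
Proof.
rewrite alphaE; apply: nc_count_split => k l;
  by rewrite /good_stat /pure_stat /mixed_stat; lia.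
Qed.

Lemma mixed_count0 : mixed_count 0 = 0.
Proof. by rewrite /mixed_count muln0 nc_count0. Qed.

(** If the predecessor of the last point is odd, then the left part ends at an odd
    element, whose block is good as soon as it has no other odd element: the left
    part is counted by beta. *)
Lemma mixed_countS n :
  mixed_count n.+1 = conv mixed_count betaS n + conv betaS alpha n.
Proof.
rewrite /mixed_count nc_count_even; congr (_ + _); apply: eq_bigr => j _.
congr (_ * _); rewrite /betaS betaE.
rewrite (@nc_count_split _ good_stat mixed_stat (pure_stat false))
  ?[X in _ + X]nc_count_pure0 ?addn0 //.
- by move=> k l /andP[/eqP].
- by rewrite /odd_point mul2n odd_double.
- by move=> k l; rewrite /good_stat /pure_stat /mixed_stat; lia.
- by move=> k l; rewrite /pure_stat /mixed_stat; lia.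
Qed.

(** The exponent s is the size of the last block; it never exceeds n, so any bound
    M > n will do. *)
Lemma pure_count_sum p M n : n < M ->
  pure_count p n =
  \sum_(s < M | odd s == p) iter s (conv (delay betaS)) delta n.
Proof.
elim: M p n => // M IHM p n nM; rewrite big_mkcond big_ord_recl /=.
case: n nM => [|n] nM.
  rewrite pure_count0 big1 ?addn0 => [|i _]; first by case: p.
  by rewrite -iterS iter_conv0 // if_same.
rewrite pure_countS if_same add0n convC -conv_delayS.
under eq_bigr => i _ do rewrite /= eqb_negLR.
rewrite -big_mkcond -conv_sumr.
by apply: eq_conv_delay => i ni; apply: IHM; lia.
Qed.

Lemma betaS_sum n :
  betaS n = \sum_(s < n.+1) iter s (conv (delay betaS)) (delay alpha) n.+1.
Proof.
rewrite betaS_conv convC -conv_delayS convC.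
pose P i := \sum_(s < n.+1) iter s (conv (delay betaS)) delta i.
transitivity (conv P (delay alpha) n.+1).
  rewrite ![conv _ (delay _) _]convC; apply: eq_conv_delay => i im.
  rewrite !(@pure_count_sum _ n.+1) // /P.
  rewrite [RHS](bigID (fun s : 'I__ => odd s)) [RHS]addnC /=.
  by congr (_ + _); apply: eq_bigl => s; case: odd.
by rewrite conv_suml; apply: eq_bigr => s _; rewrite conv_iter.
Qed.

Lemma pure_even_sum n : 0 < n ->
  pure_count false n =
  \sum_(s < n | odd s) iter s (conv (delay betaS)) (delay betaS) n.
Proof.
move=> n0; rewrite (@pure_count_sum _ n.+1) // big_mkcond big_ord_recl /=.
rewrite (_ : delta n = 0) ?add0n; last by rewrite /delta; lia.
rewrite [RHS]big_mkcond; apply: eq_bigr => s _.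
by rewrite /= -iterS iter_conv_delta; case: odd.
Qed.

(** By [betaS_conv], betaS is the convolution of alpha with the number A of
    partitions with a pure or empty last block, and the recurrence for
    [pure_count] reads A = delta + delay betaS * A. Replacing A by the right-hand
    side gives the claim. *)
Lemma betaS_fix n : betaS n = alpha n + conv (delay betaS) betaS n.
Proof.
pose A i := pure_count false i + pure_count true i.
have AE i : A i = delta i + conv (delay betaS) A i.
  case: i => [|i]; first by rewrite /A !pure_count0 conv_delay0.
  rewrite conv_delayS {1}/A !pure_countS -convDl [LHS]convC.
  by apply: eq_conv => // j _; apply: addnC.
rewrite betaS_conv -/A -[in RHS](conv_delta alpha).
rewrite (eq_conv (g' := alpha) (fun i _ => AE i)) // convDl; congr (_ + _).
by rewrite -convA; apply: eq_conv => // i _; rewrite betaS_conv.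
Qed.

(** Both sides are the solution x of x = delay betaS * alpha + delay betaS * x. *)
Lemma mixed_count_conv n : mixed_count n = conv (delay betaS) betaS n.
Proof.
move: n; apply: (@conv_delay_fix betaS (conv (delay betaS) alpha)) => n.
  case: n => [|n]; first by rewrite mixed_count0 !conv_delay0.
  by rewrite mixed_countS !conv_delayS convC addnC.
by rewrite -convDr; apply: eq_conv => // i _; apply: betaS_fix.
Qed.

Theorem theorem4p1 :
  [/\ alpha 1 = 1, beta 1 = 1 &
    forall n : nat, 2 <= n ->
      alpha n =
        \sum_(1 <= s < n.+1 | ~~ odd s) \sum_(r in compositions s n)
           \prod_(1 <= i < s.+1) beta (part r i)
        + \sum_(1 <= j < n.+1) beta j * beta (n + 1 - j)
      /\
      beta n =
        \sum_(1 <= s < n.+1) \sum_(r in compositions s n)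
           (\prod_(1 <= i < s) beta (part r i)) * alpha (part r s - 1)].
Proof.
have a0 : alpha 0 = 1 by [].
have b1 : beta 1 = 1.
  by rewrite -/(betaS 0) betaS_conv /conv big_ord1 !pure_count0 a0.
split=> //.
  rewrite alpha_split pure_countS mixed_countS /conv !big_ord1.
  by rewrite pure_count0 mixed_count0 a0 /betaS b1.
case=> // n _; split.
  rewrite alpha_split pure_even_sum // mixed_count_conv; congr (_ + _).
    rewrite big_add1 /= big_mkord.
    apply: eq_big => [s|s _]; first by rewrite negbK.
    rewrite -sum_compositions //; apply: eq_bigr => r cr.
    rewrite big_add1 /= big_mkord big_ord_recr /=; congr (_ * _).
      apply: eq_bigr => i _.
      by rewrite /part -(prednK (compositions_gt0 cr (ltnW (ltn_ord i)))).
    by rewrite /part -(prednK (compositions_gt0 cr (ltnSn s))).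
  rewrite conv_delayS big_add1 /= big_mkord; apply: eq_bigr => j _.
  by rewrite /betaS; congr (_ * beta _); have := ltn_ord j; lia.
rewrite -/(betaS n) betaS_sum big_add1 /= big_mkord; apply: eq_bigr => s _.
rewrite -sum_compositions //; apply: eq_bigr => r cr.
rewrite big_add1 /= big_mkord; congr (_ * _).
  apply: eq_bigr => i _.
  by rewrite /part -(prednK (compositions_gt0 cr (ltnW (ltn_ord i)))).
rewrite /part subn1.
by case: (nth _ _ _) (compositions_gt0 cr (ltnSn s)) => [[|k]].
Qed.
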